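(* Let $\mathcal{H}_1,\mathcal{H}_2$ be separable Hilbert spaces with orthonormal bases $\{e_{1,n}\}_{n>0}$, $\{e_{2,n}\}_{n>0}$. For $j\in\{1,2\}$, let $\{f_{j,1,n}\}_{n>0},\dots,\{f_{j,r,n}\}_{n>0}$ be linearly independent sequences in $\mathcal{H}_j$, and let $\mathcal{F}=\{f_{m,n}\}_{m,n>0}$ with $f_{m,n}=\sum_{k=1}^r f_{1,k,m}\otimes f_{2,k,n}$ in $\mathcal{H}_1\otimes\mathcal{H}_2$. Let $F_{j,k}$ be the operator associated to $\{e_{j,n}\}$ and $\{f_{j,k,n}\}$. (i) $\mathcal{F}$ is a Bessel sequence in $\mathcal{H}_1\otimes\mathcal{H}_2$ if and only if $\{f_{j,k,n}\}_{n>0}$ is a Bessel sequence in $\mathcal{H}_j$ for each $(j,k)\in\{1,2\}\times\{1,\dots,r\}$. (ii) If $\mathcal{F}$ is a frame, then (each $F_{j,k}$ is bounded and) there exist operators $L_{j,k}\in\mathcal{B}(\mathcal{H}_j)$ with $\sum_{k=1}^r L_{j,k}F_{j,k}=I_{\mathcal{H}_j}$ for each $j\in\{1,2\}$; moreover, for each $j=1,2$ the concatenated sequence $\{f_{j,k,m}\}_{1\le k\le r,\,m>0}$ is a frame in $\mathcal{H}_j$. (iii) If $\mathcal{F}$ is a Riesz basis of $\mathcal{H}_1\otimes\mathcal{H}_2$, then in addition to the conclusion of (ii) there exist operators $R_{j,k}\in\mathcal{B}(\mathcal{H}_j)$ with $\sum_{k=1}^r F_{j,k}R_{j,k}=I_{\mathcal{H}_j}$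 for each $j\in\{1,2\}$.
   Context: Given an orthonormal basis $\{e_n\}$ of $\mathcal{H}$ and a sequence $\{f_n\}$ in $\mathcal{H}$, the associated operator is $F(f)=\sum_n\langle f,f_n\rangle e_n$ on its domain $\{f: \sum_n|\langle f,f_n\rangle|^2<\infty\}$; it is bounded exactly when $\{f_n\}$ is a Bessel sequence. Bessel sequence: $\sum_n|\langle f,f_n\rangle|^2\le B\|f\|^2$ for all $f$; frame: additionally $A\|f\|^2\le\sum_n|\langle f,f_n\rangle|^2$ with $A>0$; Riesz basis: a frame which is the image of an orthonormal basis under a bounded invertible operator. Linear independence of sequences is meant in the vector space of sequences in $\mathcal{H}_j$. *)

(* Defs.v *)
(* Scalars: complex numbers C := R[i]
   over an arbitrary R : realType (mathcomp-real-closed's [complex]). *)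
From mathcomp Require Import all_boot all_order all_algebra.
From mathcomp Require Import all_classical all_reals all_analysis.
From mathcomp Require Import complex.
Set Implicit Arguments. Unset Strict Implicit. Unset Printing Implicit Defensive.
Import Order.TTheory GRing.Theory Num.Theory.
Local Open Scope ring_scope.

Notation normc := ComplexField.Normc.normc.

Section Hilbert.
Variable R : realType.
Local Notation C := R[i].

(* ---------- inner product spaces / Hilbert spaces ---------- *)
Section Space.
Variables (V : lmodType C) (ip : V -> V -> C).

(* norm induced by the inner product *)
Definition hnorm (x : V) : R := Num.sqrt (@complex.Re R (ip x x)).

(* norm convergence of a sequence *)
Definition hconverges (u : nat -> V) (l : V) : Prop :=
  forall eps : R, 0 < eps -> exists N, forall n, (N <= n)%N -> hnorm (u n - l) < eps.

Definition hcauchy (u : nat -> V) : Prop :=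
  forall eps : R, 0 < eps -> exists N, forall m n, (N <= m)%N -> (N <= n)%N ->
    hnorm (u m - u n) < eps.

(* (V, ip) is a complex Hilbert space: ip is a (complex) inner product,
   linear in the first and conjugate-linear in the second argument,
   and V is complete for the induced norm. *)
Definition is_hilbert : Prop :=
  [/\ (forall (a : C) (x y z : V), ip (a *: x + y) z = a * ip x z + ip y z),
      (forall x y : V, ip x y = (ip y x)^*),
      (forall x : V, 0 <= ip x x),
      (forall x : V, ip x x = 0 -> x = 0) &
      (forall u : nat -> V, hcauchy u -> exists l, hconverges u l)].

(* orthonormal basis indexed by a type I (orthonormal + maximal/complete) *)
Definition is_onb (I : eqType) (e : I -> V) : Prop :=
  (forall m n, ip (e m) (e n) = (m == n)%:R) /\
  (forall x, (forall n, ip x (e n) = 0) -> x = 0).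

(* bounded (= continuous) linear operators, B(V) *)
Definition is_linear_op (T : V -> V) : Prop :=
  forall (a : C) (x y : V), T (a *: x + y) = a *: T x + T y.

Definition is_bounded_op (T : V -> V) : Prop :=
  is_linear_op T /\ exists M : R, forall x, hnorm (T x) <= M * hnorm x.

(* bounded operator with a bounded inverse *)
Definition is_bounded_invertible_op (T : V -> V) : Prop :=
  is_bounded_op T /\
  exists S : V -> V, [/\ is_bounded_op S, (forall x, S (T x) = x) & (forall x, T (S x) = x)].

(* sum_{i in I} |<f, g_i>|^2 as an extended real (unordered sum of a
   nonnegative family) *)
Definition coef_sqsum (I : choiceType) (g : I -> V) (f : V) : \bar R :=
  (\esum_(i in [set: I]) ((normc (ip f (g i))) ^+ 2)%:E)%E.

Definition is_bessel (I : choiceType) (g : I -> V) : Prop :=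
  exists B : R, forall f, (coef_sqsum g f <= (B * hnorm f ^+ 2)%:E)%E.

Definition is_frame (I : choiceType) (g : I -> V) : Prop :=
  exists A B : R, 0 < A /\ forall f,
    ((A * hnorm f ^+ 2)%:E <= coef_sqsum g f)%E /\
    (coef_sqsum g f <= (B * hnorm f ^+ 2)%:E)%E.

(* Riesz basis: a frame which is the image of an orthonormal basis under a
   bounded invertible operator *)
Definition is_riesz_basis (I : choiceType) (g : I -> V) : Prop :=
  is_frame g /\
  exists (u : I -> V) (U : V -> V),
    [/\ is_onb u, is_bounded_invertible_op U & forall i, g i = U (u i)].

(* T is the operator F associated to the ONB e and the sequence g, and it is
   everywhere defined:  F f = sum_n <f, g_n> e_n  (norm-convergent) for all f *)
Definition is_assoc_op (e g : nat -> V) (T : V -> V) : Prop :=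
  forall f, hconverges (fun N => \sum_(n < N) ip f (g n) *: e n) (T f).

(* linear independence of r sequences in V, as elements of the vector space
   of sequences V^nat *)
Definition seq_lin_indep (r : nat) (g : 'I_r -> nat -> V) : Prop :=
  forall c : 'I_r -> C, (forall n, \sum_(k < r) c k *: g k n = 0) -> forall k, c k = 0.

(* conclusion of (ii) for one factor H_j:
   each F_{j,k} is bounded (everywhere defined, in B(H_j)), there are
   L_{j,k} in B(H_j) with sum_k L_{j,k} F_{j,k} = I, and the concatenated
   sequence {f_{j,k,m}}_{k,m} is a frame *)
Definition concl_ii (r : nat) (e : nat -> V) (g : 'I_r -> nat -> V) : Prop :=
  [/\ exists F : 'I_r -> V -> V,
        (forall k, is_bounded_op (F k) /\ is_assoc_op e (g k) (F k)) /\
        exists L : 'I_r -> V -> V,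
          (forall k, is_bounded_op (L k)) /\
          (forall x, \sum_(k < r) L k (F k x) = x)
    & is_frame (fun p : 'I_r * nat => g p.1 p.2)].

(* conclusion of (iii) for one factor: (ii) together with R_{j,k} in B(H_j)
   such that sum_k F_{j,k} R_{j,k} = I *)
Definition concl_iii (r : nat) (e : nat -> V) (g : 'I_r -> nat -> V) : Prop :=
  [/\ exists F : 'I_r -> V -> V,
        (forall k, is_bounded_op (F k) /\ is_assoc_op e (g k) (F k)) /\
        (exists L : 'I_r -> V -> V,
          (forall k, is_bounded_op (L k)) /\
          (forall x, \sum_(k < r) L k (F k x) = x)) /\
        (exists Rk : 'I_r -> V -> V,
          (forall k, is_bounded_op (Rk k)) /\
          (forall x, \sum_(k < r) F k (Rk k x) = x))
    & is_frame (fun p : 'I_r * nat => g p.1 p.2)].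

End Space.

(* (H, ip, t) is the Hilbert tensor product of (H1, ip1) and (H2, ip2):
   t is bilinear, <x1 (x) x2, y1 (x) y2> = <x1,y1><x2,y2>, and the linear span
   of the elementary tensors is dense in H.  This characterises H1 (x) H2 up to
   unitary isomorphism. *)
Definition is_tensor_product (H1 H2 H : lmodType C)
  (ip1 : H1 -> H1 -> C) (ip2 : H2 -> H2 -> C) (ip : H -> H -> C)
  (t : H1 -> H2 -> H) : Prop :=
  [/\ (forall (a : C) x x' y, t (a *: x + x') y = a *: t x y + t x' y),
      (forall (a : C) x y y', t x (a *: y + y') = a *: t x y + t x y'),
      (forall x y x' y', ip (t x y) (t x' y') = ip1 x x' * ip2 y y') &
      (forall (z : H) (eps : R), 0 < eps ->
         exists s : seq (H1 * H2), hnorm ip (z - \sum_(p <- s) t p.1 p.2) < eps)].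

End Hilbert.

(* Main.v *)
(* Testing a frame bound on elementary tensors x (x) y turns it into a bound on
   products of sums over the two factors; fixing y then leaves a joint bound for
   the operators F_{1,k}. By linear independence of the sequences f_{2,k},
   finitely many vectors (<y, f_{2,k,n}>)_k already span C^r, so each coefficient
   <x, f_{1,k,m}> is a fixed finite combination of coefficients of elementary
   tensors with respect to the family; hence the factors of a Bessel family are
   Bessel. In the converse direction Parseval is used in one factor at a time.
   A joint lower bound c |x|^2 <= sum_k |T_k x|^2 makes sum_k T_k^* T_k coercive,
   hence invertible, which gives left inverses. For a frame this applies to
   T_k = F_{j,k}. For a Riesz basis, the lower Riesz bound on the subfamily
   (f_{m,0})_m lets one apply it to T_k = F_{1,k}^*, and the adjoints of the left
   inverses of these are the required R_{1,k}. *)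
Require Import Defs.
From mathcomp Require Import all_boot all_order all_algebra.
From mathcomp Require Import all_classical all_reals all_analysis.
From mathcomp Require Import complex.
From mathcomp Require Import ring lra.
Import Order.TTheory GRing.Theory Num.Theory.
Local Open Scope ring_scope.
Set Implicit Arguments. Unset Strict Implicit. Unset Printing Implicit Defensive.

(** * Complex inner products *)

Section ComplexModulus.
Context {R : realType}.
Implicit Types (z w : R[i]).

Lemma normc_sqrC z : ((normc z ^+ 2)%:C)%C = z * z^*.
Proof.
case: z => a b; rewrite /normc sqr_sqrtr ?addr_ge0 ?sqr_ge0//.
by apply/eqP; rewrite eq_complex /= !mulrN opprK -!expr2 [b * a]mulrC addNr !eqxx.
Qed.

Lemma normc_ge0 z : 0 <= normc z.
Proof. by case: z => a b; exact: sqrtr_ge0. Qed.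

Lemma normc_conj z : normc z^* = normc z.
Proof. by case: z => a b; rewrite /normc/= sqrrN. Qed.

Lemma normc_real (a : R) : normc (a%:C)%C = `|a|.
Proof. by rewrite /normc/= expr0n/= addr0 sqrtr_sqr. Qed.

Lemma Re_le_normc z : complex.Re z <= normc z.
Proof.
case: z => a b /=; apply: (le_trans (ler_norm _)).
by rewrite -sqrtr_sqr; apply: ler_wsqrtr; rewrite lerDl sqr_ge0.
Qed.

Lemma Re_conj z : complex.Re z^* = complex.Re z.
Proof. by case: z. Qed.

Lemma Re_sum (I : Type) (s : seq I) (P : pred I) (F : I -> R[i]) :
  complex.Re (\sum_(i <- s | P i) F i) = \sum_(i <- s | P i) complex.Re (F i).
Proof. by apply: (big_morph (@complex.Re R)) => // -[a b] [c d]. Qed.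

Lemma complex_of_realM (a b : R) : ((a * b)%:C)%C = (a%:C * b%:C)%C.
Proof. exact: rmorphM. Qed.

Lemma ler_normc_sum (I : Type) (s : seq I) (P : pred I) (F : I -> R[i]) :
  normc (\sum_(i <- s | P i) F i) <= \sum_(i <- s | P i) normc (F i).
Proof.
elim/big_ind2 : _ => [|x1 x2 y1 y2 h1 h2|//]; first by rewrite ComplexField.Normc.normc0.
by apply: le_trans (le_normcD _ _) _; apply: lerD.
Qed.

End ComplexModulus.

(** Cauchy-Schwarz against the constant family 1. With [n] the length of the tail and [S] its sum,
    adding one term [a] and multiplying by [n] reduces the claim to [(n a - S)^2 >= 0]. *)
Lemma sqr_sum_le {R : realDomainType} (I : Type) (s : seq I) (F : I -> R) :
  (\sum_(i <- s) F i) ^+ 2 <= (size s)%:R * \sum_(i <- s) F i ^+ 2.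
Proof.
elim: s => [|i s IH]; first by rewrite !big_nil expr0n mul0r.
rewrite !big_cons /= -natr1.
set S := \sum_(j <- s) F j in IH *; set Q := \sum_(j <- s) _ in IH *.
set a := F i; have hQ : 0 <= Q by apply: sumr_ge0 => j _; exact: sqr_ge0.
have n0 : (0 : R) <= (size s)%:R by [].
(* The case of an empty tail is treated apart, because its length is the factor to multiply by
   afterwards. *)
have [n0'|n0'] := eqVneq ((size s)%:R : R) 0.
  rewrite n0' mul0r in IH *; have S0 : S = 0 by apply/eqP; rewrite -sqrf_eq0 eq_le IH sqr_ge0.
  by rewrite S0 addr0 add0r mul1r lerDl.
have n1 : (0 : R) < (size s)%:R by rewrite lt_neqAle eq_sym n0'.
rewrite -(ler_pM2l n1).
have := sqr_ge0 ((size s)%:R * a - S); nra.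
Qed.

Lemma sqr_normc_sum_le {R : realType} (n : nat) (F : 'I_n -> R[i]) :
  normc (\sum_(i < n) F i) ^+ 2 <= n%:R * \sum_(i < n) normc (F i) ^+ 2.
Proof.
apply: le_trans (_ : (\sum_(i < n) normc (F i)) ^+ 2 <= _).
  rewrite ler_pXn2r ?nnegrE ?sumr_ge0 ?normc_ge0//; first exact: ler_normc_sum.
  by move=> i _; exact: normc_ge0.
apply: le_trans (sqr_sum_le _ _) _.
by rewrite /index_enum -enumT size_enum_ord.
Qed.

Section InnerProduct.
Context {R : realType} {V : lmodType R[i]} {ip : V -> V -> R[i]}.
Hypothesis hV : is_hilbert ip.
Local Notation N := (hnorm ip).
Implicit Types (x y z : V) (a : R[i]).

Lemma ip_conj x y : ip x y = (ip y x)^*.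
Proof. by case: hV. Qed.

Lemma ip0l y : ip 0 y = 0.
Proof.
case: hV => h _ _ _ _; have := h 1 0 0 y; rewrite scaler0 addr0 mul1r.
by move/eqP; rewrite -subr_eq0 opprD addNKr oppr_eq0 => /eqP.
Qed.

Lemma ipDl x y z : ip (x + y) z = ip x z + ip y z.
Proof. by case: hV => h _ _ _ _; rewrite -[x in LHS]scale1r h mul1r. Qed.

Lemma ipZl a x y : ip (a *: x) y = a * ip x y.
Proof. by case: hV => h _ _ _ _; rewrite -[a *: x]addr0 h ip0l addr0. Qed.

Lemma ipNl x y : ip (- x) y = - ip x y.
Proof. by rewrite -scaleN1r ipZl mulN1r. Qed.

Lemma ipBl x y z : ip (x - y) z = ip x z - ip y z.
Proof. by rewrite ipDl ipNl. Qed.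

Lemma ip_suml (I : Type) (s : seq I) (P : pred I) (F : I -> V) y :
  ip (\sum_(i <- s | P i) F i) y = \sum_(i <- s | P i) ip (F i) y.
Proof. by apply: (big_morph (ip^~ y) (fun x z => ipDl x z y)); exact: ip0l. Qed.

Lemma ip0r x : ip x 0 = 0.
Proof. by rewrite ip_conj ip0l conjC0. Qed.

Lemma ipDr x y z : ip x (y + z) = ip x y + ip x z.
Proof. by rewrite ip_conj ipDl rmorphD/= -!ip_conj. Qed.

Lemma ipZr a x y : ip x (a *: y) = a^* * ip x y.
Proof. by rewrite ip_conj ipZl rmorphM/= -ip_conj. Qed.

Lemma ipNr x y : ip x (- y) = - ip x y.
Proof. by rewrite ip_conj ipNl rmorphN/= -ip_conj. Qed.

Lemma ip_sumr (I : Type) (s : seq I) (P : pred I) (F : I -> V) x :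
  ip x (\sum_(i <- s | P i) F i) = \sum_(i <- s | P i) ip x (F i).
Proof. by apply: (big_morph (ip x) (fun y z => ipDr x y z)); exact: ip0r. Qed.

Lemma hnorm_ge0 x : 0 <= N x.
Proof. exact: sqrtr_ge0. Qed.

Lemma ip_self x : ip x x = ((N x ^+ 2)%:C)%C.
Proof.
case: hV => _ _ h _ _; have := h x; rewrite /hnorm; case: (ip x x) => a b.
rewrite lecE /= => /andP[/eqP -> a0]; by rewrite sqr_sqrtr.
Qed.

Lemma hnorm_sqr x : N x ^+ 2 = complex.Re (ip x x).
Proof. by rewrite ip_self. Qed.

Lemma hnorm_eq0 x : N x = 0 -> x = 0.
Proof. by move=> h; case: hV => _ _ _ + _; apply; rewrite ip_self h expr0n. Qed.

Lemma hnorm0 : N 0 = 0.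
Proof. by rewrite /hnorm ip0l sqrtr0. Qed.

Lemma hnormZ a x : N (a *: x) = normc a * N x.
Proof.
apply/eqP; rewrite -(eqrXn2 (n:=2))// ?mulr_ge0 ?normc_ge0 ?hnorm_ge0//.
apply/eqP; rewrite hnorm_sqr ipZl ipZr mulrA -normc_sqrC ip_self.
by rewrite -rmorphM/= exprMn.
Qed.

Lemma hnormN x : N (- x) = N x.
Proof. by rewrite /hnorm ipNl ipNr opprK. Qed.

Lemma hnormBC x y : N (x - y) = N (y - x).
Proof. by rewrite -opprB hnormN. Qed.

Lemma hnorm_sqrD x y :
  N (x + y) ^+ 2 = N x ^+ 2 + 2 * complex.Re (ip x y) + N y ^+ 2.
Proof.
rewrite !hnorm_sqr ipDl !ipDr (ip_conj y x).
move: (ip x x) (ip x y) (ip y y) => [a b] [c d] [e f] /=; ring.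
Qed.

Lemma hnorm_sqrB x y :
  N (x - y) ^+ 2 = N x ^+ 2 - 2 * complex.Re (ip x y) + N y ^+ 2.
Proof. by rewrite hnorm_sqrD hnormN ipNr; case: (ip x y) => a b /=; rewrite mulrN. Qed.

Lemma cauchy_schwarz x y : normc (ip x y) <= N x * N y.
Proof.
have [y0|y0] := eqVneq (N y) 0.
  by rewrite (hnorm_eq0 y0) ip0r ComplexField.Normc.normc0 hnorm0 mulr0.
have yp : 0 < N y by rewrite lt_neqAle eq_sym y0 hnorm_ge0.
rewrite -(ler_pXn2r (n:=2))// ?nnegrE ?mulr_ge0 ?normc_ge0 ?hnorm_ge0//.
(* This vector is [|y|^2] times the component of [x] orthogonal to [y]; its squared norm is
   [|y|^2 (|x|^2 |y|^2 - |<x,y>|^2)]. *)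
have := sqr_ge0 (N (((N y ^+ 2)%:C)%C *: x - ip x y *: y)).
rewrite hnorm_sqrB !hnormZ normc_real ger0_norm ?sqr_ge0// ipZl ipZr mulrA [_ * _ * ip x y]mulrAC -[_ * _ * _]mulrA.
rewrite -normc_sqrC -rmorphM/=.
move: (normc _) (N x) (N y) yp => p q s sp h.
have s2 : 0 < s ^+ 2 by rewrite exprn_gt0.
rewrite -(ler_pM2l s2); nra.
Qed.

Lemma hnormD x y : N (x + y) <= N x + N y.
Proof.
rewrite -(ler_pXn2r (n:=2))// ?nnegrE ?addr_ge0 ?hnorm_ge0// hnorm_sqrD.
have := le_trans (Re_le_normc _) (cauchy_schwarz x y); nra.
Qed.

Lemma hnorm_sum (I : Type) (s : seq I) (P : pred I) (F : I -> V) :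
  N (\sum_(i <- s | P i) F i) <= \sum_(i <- s | P i) N (F i).
Proof.
elim/big_ind2 : _ => [|x1 x2 y1 y2 h1 h2|//]; first by rewrite hnorm0.
by apply: le_trans (hnormD _ _) _; apply: lerD.
Qed.

Lemma ip_ext x y : (forall z, ip x z = ip y z) -> x = y.
Proof.
move=> h; apply/eqP; rewrite -subr_eq0; apply/eqP/hnorm_eq0.
apply/eqP; rewrite -sqrf_eq0 hnorm_sqr ipBl h subrr; exact/eqP.
Qed.

End InnerProduct.

Arguments hnorm_ge0 {R V} ip x.

(** * Orthonormal bases and the Riesz representation *)

Lemma ler_eps_mul {R : realType} (a b K : R) :
  0 <= K -> (forall e, 0 < e -> a <= b + e * K) -> a <= b.
Proof.
move=> K0 h; apply/ler_addgt0Pr => e e0.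
have K1 : 0 < K + 1 by rewrite ltr_wpDl.
(* The denominator [K + 1] also covers [K = 0]. *)
apply: le_trans (h (e / (K + 1)) (divr_gt0 e0 K1)) _.
by rewrite lerD2l mulrAC ler_pdivrMr// ler_wpM2l ?ltW// ltrDl.
Qed.

Section HilbertSpace.
Context {R : realType} {V : lmodType R[i]} {ip : V -> V -> R[i]}.
Hypothesis hV : is_hilbert ip.
Local Notation N := (hnorm ip).
Implicit Types (x y z : V) (a : R[i]).

Lemma hconverges_norm_le u l (M : R) :
  hconverges ip u l -> (forall n, N (u n) <= M) -> N l <= M.
Proof.
move=> ul uM; apply/ler_addgt0Pr => e e0; have [n0 /(_ n0 (leqnn _)) hn] := ul e e0.
rewrite -[l](subrK (u n0)) addrC; apply: le_trans (hnormD hV _ _) _.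
by rewrite lerD// (hnormBC hV) ltW.
Qed.

(** Continuity of the inner product, by Cauchy-Schwarz, in the form suited to orthonormal series:
    tested on a basis vector, the partial sums no longer change once the index of that vector has
    been passed. *)
Lemma hconverges_ip u l y c n0 :
  hconverges ip u l -> (forall n, (n0 <= n)%N -> ip (u n) y = c) -> ip l y = c.
Proof.
move=> ul hc; apply/eqP; rewrite -subr_eq0; apply/eqP/ComplexField.Normc.eq0_normc.
apply/eqP; rewrite eq_le normc_ge0 andbT.
apply: (ler_eps_mul (hnorm_ge0 ip y)) => e e0; have [n1 h1] := ul e e0.
rewrite -(hc (maxn n0 n1)) ?leq_maxl// -(ipBl hV) add0r.
apply: le_trans (cauchy_schwarz hV _ _) _; apply: ler_wpM2r; first exact: hnorm_ge0.
by rewrite (hnormBC hV) ltW// h1// leq_maxr.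
Qed.

Lemma hcauchy_le u :
  (forall eps, 0 < eps -> exists n0, forall m n, (n0 <= m)%N -> (m <= n)%N ->
     N (u n - u m) < eps) -> hcauchy ip u.
Proof.
move=> h eps eps0; have [n0 hn0] := h eps eps0.
exists n0 => m n n0m n0n; have [mn|/ltnW nm] := leqP m n; last exact: hn0.
by rewrite (hnormBC hV); exact: hn0.
Qed.

Section Orthonormal.
Context {I : eqType} {e : I -> V}.
Hypothesis he : forall m n, ip (e m) (e n) = (m == n)%:R.

Lemma orthonormal_ip (s : seq I) (c : I -> R[i]) j : uniq s ->
  ip (\sum_(i <- s) c i *: e i) (e j) = if j \in s then c j else 0.
Proof.
move=> us; rewrite (ip_suml hV).
under eq_bigr do rewrite (ipZl hV) he.
case: ifPn => js.
  rewrite (bigD1_seq j)//= eqxx mulr1 big1 ?addr0// => i /negbTE ->.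
  by rewrite mulr0.
rewrite big_seq big1// => i si; case: eqP => [ij|]; last by rewrite mulr0.
by rewrite -ij si in js.
Qed.

Lemma hnorm_orthonormal (s : seq I) (c : I -> R[i]) : uniq s ->
  N (\sum_(i <- s) c i *: e i) ^+ 2 = \sum_(i <- s) normc (c i) ^+ 2.
Proof.
move=> us; rewrite (hnorm_sqr hV) (ip_sumr hV) Re_sum big_seq [RHS]big_seq.
apply: eq_bigr => i si.
by rewrite (ipZr hV) orthonormal_ip// si mulrC -normc_sqrC.
Qed.

(** The squared distance from [x] to its projection on the span of the chosen vectors is
    nonnegative. *)
Lemma bessel_inequality (s : seq I) x : uniq s ->
  \sum_(i <- s) normc (ip x (e i)) ^+ 2 <= N x ^+ 2.
Proof.
move=> us; have := sqr_ge0 (N (x - \sum_(i <- s) ip x (e i) *: e i)).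
rewrite (hnorm_sqrB hV) hnorm_orthonormal// (ip_sumr hV) Re_sum.
under eq_bigr do rewrite (ipZr hV) mulrC -normc_sqrC/=.
lra.
Qed.

End Orthonormal.

Lemma coef_sqsum_orthonormal (I : choiceType) (e : I -> V) x :
  (forall m n, ip (e m) (e n) = (m == n)%:R) ->
  (coef_sqsum ip e x <= (N x ^+ 2)%:E)%E.
Proof.
move=> he; apply: ub_ereal_sup => _ [A [finA _] <-].
rewrite fsbig_finite//= sumEFin lee_fin.
exact: (bessel_inequality he x (finmap.fset_uniq _)).
Qed.

Lemma coef_sqsum_ge_partial (g : nat -> V) x n :
  ((\sum_(i < n) normc (ip x (g i)) ^+ 2)%:E <= coef_sqsum ip g x)%E.
Proof.
rewrite -(big_mkord xpredT (fun i => normc (ip x (g i)) ^+ 2)).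
apply: esum_ge; exists `I_n; first by split => //; exact: finite_II.
by rewrite -fsbig_ord -sumEFin big_mkord.
Qed.


Section Basis.
Context {e : nat -> V}.
Hypothesis he : is_onb ip e.

(** By orthonormality the squared distance of two partial sums is a difference of the bounded
    increasing sequence [s]; hence the partial sums are Cauchy and completeness gives the limit. *)
Lemma riesz_fischer (c : nat -> R[i]) (M : R) :
  (forall n, \sum_(i < n) normc (c i) ^+ 2 <= M) ->
  exists l, hconverges ip (fun n => \sum_(i < n) c i *: e i) l /\
            forall n, ip l (e n) = c n.
Proof.
move=> hM; pose s n := \sum_(i < n) normc (c i) ^+ 2.
have sup_s : has_sup (range s).
  by split; [exists (s 0%N), 0%N|exists M => _ [n _ <-]; exact: hM].
have s_diff m n : (m <= n)%N ->
    N (\sum_(i < n) c i *: e i - \sum_(i < m) c i *: e i) ^+ 2 = s n - s m.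
  move=> mn; rewrite /s -!(big_mkord xpredT (fun i => c i *: e i)).
  rewrite -!(big_mkord xpredT (fun i => normc (c i) ^+ 2)).
  rewrite !(big_cat_nat (leq0n m) mn)//= !(addrAC _ _ (- _)) !subrr !add0r.
  by rewrite (hnorm_orthonormal he.1)// iota_uniq.
have [l ul] : exists l, hconverges ip (fun n => \sum_(i < n) c i *: e i) l.
  case: hV => _ _ _ _; apply; apply: hcauchy_le => eps eps0.
  (* From [n0] on, [s] stays within [eps ^+ 2] of its supremum. *)
  have [_ [n0 _ <-] hn0] := sup_adherent (exprn_gt0 2 eps0) sup_s.
  exists n0 => m n n0m mn.
  rewrite -(ltr_pXn2r (n:=2))// ?nnegrE ?hnorm_ge0 ?ltW// s_diff//.
  have h1 : s n <= sup (range s) by apply: sup_upper_bound => //; exists n.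
  have h2 : s n0 <= s m.
    rewrite /s -!(big_mkord xpredT (fun i => normc (c i) ^+ 2)).
    rewrite [leRHS](big_cat_nat (leq0n _) n0m)//= lerDl.
    by apply: sumr_ge0 => *; exact: sqr_ge0.
  lra.
exists l; split => // n; apply: (hconverges_ip (n0 := n.+1) ul) => k nk.
rewrite -(big_mkord xpredT (fun i => c i *: e i)).
by rewrite (orthonormal_ip he.1) ?iota_uniq// mem_index_iota nk.
Qed.

Lemma bessel_inequality_ord x n :
  \sum_(i < n) normc (ip x (e i)) ^+ 2 <= N x ^+ 2.
Proof.
rewrite -(big_mkord xpredT (fun i => normc (ip x (e i)) ^+ 2)).
by rewrite (bessel_inequality he.1) ?iota_uniq.
Qed.

Lemma onb_ext x y : (forall n, ip x (e n) = ip y (e n)) -> x = y.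
Proof.
move=> h; apply/eqP; rewrite -subr_eq0; apply/eqP; apply: he.2 => n.
by rewrite (ipBl hV) h subrr.
Qed.

(** Riesz-Fischer yields a sum with the same coefficients as [x], and maximality of the orthonormal
    system forces the two to agree. *)
Lemma onb_expansion x : hconverges ip (fun n => \sum_(i < n) ip x (e i) *: e i) x.
Proof.
have [l [ul hl]] := riesz_fischer (c := fun i => ip x (e i)) (bessel_inequality_ord x).
by rewrite [X in hconverges _ _ X](onb_ext (y := l))// => n; rewrite hl.
Qed.

(** One inequality is Bessel's. For the other, a finite value [M] bounds the norms of all partial
    sums by [sqrt M], and this bound passes to their limit [x]. *)
Lemma parseval x : coef_sqsum ip e x = ((N x ^+ 2)%:E)%E.
Proof.
apply/eqP; rewrite eq_le; apply/andP; split.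
  exact: (coef_sqsum_orthonormal x he.1).
have := coef_sqsum_ge_partial e x; set S := coef_sqsum _ _ _.
case: S => [M|_|/(_ 0%N)]; [move=> hM|by rewrite leey|by rewrite leeNy_eq].
have M0 : 0 <= M by have := hM 0%N; rewrite big_ord0 lee_fin.
rewrite lee_fin -(sqr_sqrtr M0) ler_pXn2r ?nnegrE ?hnorm_ge0 ?sqrtr_ge0//.
apply: (hconverges_norm_le (onb_expansion x)) => n.
rewrite -(ler_pXn2r (n:=2))// ?nnegrE ?hnorm_ge0 ?sqrtr_ge0// (sqr_sqrtr M0).
rewrite -(big_mkord xpredT (fun i => ip x (e i) *: e i)). rewrite (hnorm_orthonormal he.1) ?iota_uniq//.
by rewrite big_mkord -lee_fin.
Qed.

(** The representing vector has coordinates [(phi (e i))^*]. The two functionals then agree on the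
    partial sums of the expansion of [x], and both are continuous. *)
Lemma riesz_representation (phi : V -> R[i]) (M : R) :
  (forall a x y, phi (a *: x + y) = a * phi x + phi y) ->
  (forall x, normc (phi x) <= M * N x) ->
  exists v, forall x, phi x = ip x v.
Proof.
move=> phil phib.
have phi0 : phi 0 = 0.
  have := phil 1 0 0; rewrite scaler0 addr0 mul1r => /eqP.
  by rewrite -subr_eq0 opprD addNKr oppr_eq0 => /eqP.
have phiD x y : phi (x + y) = phi x + phi y by rewrite -[x in LHS]scale1r phil mul1r.
have phiZ a x : phi (a *: x) = a * phi x by rewrite -[a *: x]addr0 phil phi0 addr0.
have phiB x y : phi (x - y) = phi x - phi y by rewrite phiD -scaleN1r phiZ mulN1r.
have phi_sum n (c : nat -> R[i]) :
    phi (\sum_(i < n) c i *: e i) = \sum_(i < n) c i * phi (e i).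
  by rewrite (big_morph _ phiD phi0); apply: eq_bigr => i _; rewrite phiZ.
(* Testing [phi] on the partial sum [u] itself gives [|u|^2 = phi u <= M |u|], hence [|u| <= M]
   after cancelling. *)
have bnd n : \sum_(i < n) normc ((phi (e i))^*) ^+ 2 <= M ^+ 2.
  set T := \sum_(i < n) _.
  have T0 : 0 <= T by apply: sumr_ge0 => *; exact: sqr_ge0.
  pose u := \sum_(i < n) (phi (e i))^* *: e i.
  have uT : N u ^+ 2 = T.
    rewrite /u -(big_mkord xpredT (fun i => (phi (e i))^* *: e i)).
    by rewrite (hnorm_orthonormal he.1) ?iota_uniq// big_mkord.
  have : T <= M * N u.
    apply: le_trans (phib u); apply: le_trans (Re_le_normc _).
    rewrite /u (phi_sum n (fun i => (phi (e i))^*)) Re_sum; apply: ler_sum => i _.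
    by rewrite mulrC -normc_sqrC normc_conj.
  have [->|Tn0] := eqVneq T 0; first by rewrite sqr_ge0.
  have Tp : 0 < T by rewrite lt_neqAle eq_sym Tn0.
  have := hnorm_ge0 ip u; rewrite -uT in Tp *.
  move: (N u) Tp => w w2 w0 h; have wp : 0 < w by rewrite lt_neqAle w0 andbT eq_sym -sqrf_eq0 gt_eqF.
  have wM : w <= M by rewrite -(ler_pM2r wp) -expr2.
  by rewrite ler_pXn2r ?nnegrE ?(le_trans w0 wM).
have [v [vl hv]] := riesz_fischer (c := fun i => (phi (e i))^*) bnd.
exists v => x; apply/eqP; rewrite -subr_eq0; apply/eqP/ComplexField.Normc.eq0_normc.
apply/eqP; rewrite eq_le normc_ge0 andbT.
(* The sum of Lipschitz constants for [phi] and for [ip _ v]; [M] is not assumed nonnegative. *)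
have K0 : 0 <= `|M| + N v by rewrite addr_ge0 ?normr_ge0 ?hnorm_ge0.
apply: (ler_eps_mul K0) => eps eps0; rewrite add0r.
have [n /(_ n (leqnn _)) hn] := onb_expansion x eps0.
set u := \sum_(i < n) _ in hn; rewrite -[x](subrK u).
have phiu : phi u = ip u v.
  rewrite /u (phi_sum n (fun i => ip x (e i))) (ip_suml hV); apply: eq_bigr => i _.
  by rewrite (ipZl hV) [ip (e i) v](ip_conj hV) hv conjCK.
rewrite phiD (ipDl hV) phiu opprD addrACA subrr addr0.
have hn' : N (x - u) <= eps by rewrite (hnormBC hV) ltW.
rewrite mulrDr; apply: le_trans (le_normcD _ _) _; rewrite lerD//.
  apply: le_trans (phib _) _; apply: le_trans (ler_wpM2r (hnorm_ge0 _ _) (ler_norm M)) _.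
  by rewrite mulrC; apply: ler_wpM2r.
rewrite normcN; apply: le_trans (cauchy_schwarz hV _ _) _.
by apply: ler_wpM2r => //; exact: hnorm_ge0.
Qed.

End Basis.
End HilbertSpace.

(** * Bounded operators *)

Section BoundedOperators.
Context {R : realType} {V : lmodType R[i]} {ip : V -> V -> R[i]}.
Hypothesis hV : is_hilbert ip.
Local Notation N := (hnorm ip).
Implicit Types (x y z : V) (a : R[i]) (T S : V -> V).

Lemma linear_op0 T : is_linear_op T -> T 0 = 0.
Proof.
move=> h; have := h 1 0 0; rewrite !scale1r addr0 => /eqP.
by rewrite -subr_eq0 opprD addNKr oppr_eq0 => /eqP.
Qed.

Lemma linear_opD T x y : is_linear_op T -> T (x + y) = T x + T y.
Proof. by move=> h; rewrite -[x in LHS]scale1r h scale1r. Qed.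

Lemma linear_opZ T a x : is_linear_op T -> T (a *: x) = a *: T x.
Proof. by move=> h; rewrite -[a *: x]addr0 h linear_op0 ?addr0. Qed.

Lemma linear_opB T x y : is_linear_op T -> T (x - y) = T x - T y.
Proof. by move=> h; rewrite linear_opD// -scaleN1r linear_opZ// scaleN1r. Qed.

Lemma linear_op_sum T (I : Type) (s : seq I) (P : pred I) (F : I -> V) :
  is_linear_op T -> T (\sum_(i <- s | P i) F i) = \sum_(i <- s | P i) T (F i).
Proof.
move=> h; apply: big_morph; last exact: linear_op0.
by move=> x y; exact: linear_opD.
Qed.

Lemma bounded_op_gt0 T : is_bounded_op ip T ->
  exists2 M : R, 0 < M & forall x, N (T x) <= M * N x.
Proof.
move=> [_ [M hM]]; exists (`|M| + 1) => [|x]; first by rewrite ltr_wpDl.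
apply: le_trans (hM x) _; apply: ler_wpM2r; first exact: hnorm_ge0.
by apply: le_trans (ler_norm M) _; rewrite lerDl.
Qed.

Lemma bounded_op_comp T S :
  is_bounded_op ip T -> is_bounded_op ip S -> is_bounded_op ip (T \o S).
Proof.
move=> bT bS; have [M M0 hM] := bounded_op_gt0 bT; have [K _ hK] := bounded_op_gt0 bS.
split=> [a x y /=|]; first by rewrite bS.1 bT.1.
exists (M * K) => x /=; apply: le_trans (hM _) _.
by rewrite -mulrA ler_wpM2l ?(ltW M0).
Qed.

Lemma bounded_op_sum (I : finType) (F : I -> V -> V) :
  (forall i, is_bounded_op ip (F i)) -> is_bounded_op ip (fun x => \sum_i F i x).
Proof.
move=> bF; split=> [a x y|].
  rewrite scaler_sumr -big_split/=; apply: eq_bigr => i _; exact: (bF i).1.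
have [M hM] := choice (fun i => (bF i).2).
exists (\sum_i M i) => x; rewrite mulr_suml.
by apply: le_trans (hnorm_sum hV _ _ _) _; apply: ler_sum => i _; exact: hM.
Qed.

(** [S y] represents the bounded functional [x |-> ip (T x) y]. Its bound comes from
    [|S x|^2 = <T (S x), x> <= M |S x| |x|]. *)
Lemma adjoint_exists (e : nat -> V) T : is_onb ip e -> is_bounded_op ip T ->
  exists S, is_bounded_op ip S /\ forall x y, ip (T x) y = ip x (S y).
Proof.
move=> he bT; have [M M0 hM] := bounded_op_gt0 bT.
have : forall y, exists v, forall x, ip (T x) y = ip x v.
  move=> y; apply: (riesz_representation hV he (M := M * N y)) => [a x z|x].
    by rewrite bT.1 (ipDl hV) (ipZl hV).
  rewrite mulrAC; apply: le_trans (cauchy_schwarz hV _ _) _.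
  by apply: ler_wpM2r => //; exact: hnorm_ge0.
move=> /choice[S hS]; exists S; split=> //.
have hS' y z : ip (S y) z = ip y (T z) by rewrite (ip_conj hV) -hS -(ip_conj hV).
split=> [a x y|].
  apply: (ip_ext hV) => z.
  by rewrite hS' !(ipDl hV) !(ipZl hV) !hS'.
exists M => x; have [->|Sx0] := eqVneq (N (S x)) 0.
  by rewrite mulr_ge0 ?hnorm_ge0// ltW.
have Sxp : 0 < N (S x) by rewrite lt_neqAle eq_sym Sx0 hnorm_ge0.
rewrite -(ler_pM2l Sxp) -expr2 (hnorm_sqr hV) -hS.
apply: le_trans (Re_le_normc _) _; apply: le_trans (cauchy_schwarz hV _ _) _.
by rewrite mulrA [_ * M]mulrC ler_wpM2r ?hnorm_ge0.
Qed.

(* Lax-Milgram: [x |-> x - rho (S x - y)] is a contraction for [rho = c / M^2],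
   and its fixed point solves [S x = y]. *)
Lemma coercive_surjective S (c : R) : is_bounded_op ip S -> 0 < c ->
  (forall x, c * N x ^+ 2 <= complex.Re (ip (S x) x)) ->
  forall y, exists x, S x = y.
Proof.
move=> bS c0 cS y; have [M0 M00 hM0] := bounded_op_gt0 bS.
(* Adding [c] ensures [c <= M], which makes [q] below nonnegative. *)
pose M := M0 + c; have Mp : 0 < M by rewrite addr_gt0.
have hM x : N (S x) <= M * N x.
  by apply: le_trans (hM0 x) _; rewrite ler_wpM2r ?hnorm_ge0// lerDl ltW.
have M2 : 0 < M ^+ 2 by rewrite exprn_gt0.
have [rho rho0 rhoM] : exists2 rho : R, 0 < rho & rho * M ^+ 2 = c.
  by exists (c / M ^+ 2); [rewrite divr_gt0|rewrite divfK ?gt_eqF].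
(* The squared contraction factor: [1 - 2 rho c + rho^2 M^2] equals [1 - c rho] because
   [rho M^2 = c]. *)
pose q := 1 - c * rho.
have q1 : q < 1 by rewrite ltrBlDr ltrDl mulr_gt0.
have q0 : 0 <= q.
  rewrite subr_ge0 -(ler_pM2r M2) -mulrA rhoM mul1r -expr2.
  by rewrite ler_pXn2r ?nnegrE ?ltW// ltrDr.
pose kappa := Num.sqrt q.
have k0 : 0 <= kappa by exact: sqrtr_ge0.
have k1 : kappa < 1 by rewrite -sqrtr1 ltr_sqrt.
pose K x := x - (rho%:C)%C *: S x.
have hK x : N (K x) <= kappa * N x.
  rewrite -(ler_pXn2r (n:=2))// ?nnegrE ?mulr_ge0 ?hnorm_ge0//.
  rewrite (hnorm_sqrB hV) exprMn (sqr_sqrtr q0) (hnormZ hV) normc_real gtr0_norm//.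
  rewrite (ipZr hV) (ip_conj hV).
  have -> : complex.Re (((rho%:C)%C)^* * (ip (S x) x)^*) = rho * complex.Re (ip (S x) x).
    by case: (ip (S x) x) => a b /=; ring.
  have h1 : (rho * N (S x)) ^+ 2 <= c * rho * N x ^+ 2.
    have -> : c * rho * N x ^+ 2 = (rho * (M * N x)) ^+ 2.
      by rewrite -{1}rhoM; ring.
    rewrite ler_pXn2r ?nnegrE ?mulr_ge0 ?hnorm_ge0 ?(ltW rho0) ?(ltW Mp)//.
    by rewrite ler_wpM2l// ltW.
  have h2 : rho * (c * N x ^+ 2) <= rho * complex.Re (ip (S x) x).
    by rewrite ler_wpM2l// ltW.
  rewrite /q; nra.
(* Picard iterates from 0; their increments [d] evolve under the linear part [K], so they decay
   geometrically. *)
pose u := fix u n := if n is n'.+1 then u n' - (rho%:C)%C *: (S (u n') - y) else 0.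
pose d n := u n.+1 - u n.
have dE n : d n = - ((rho%:C)%C *: (S (u n) - y)) by rewrite /d /= addrAC subrr add0r.
have dK n : d n.+1 = K (d n).
  have Sd : S (d n) = S (u n.+1) - S (u n) by exact: linear_opB bS.1.
  rewrite /K Sd !dE -opprD -scalerDr; congr (- (_ *: _)).
  by rewrite [RHS]addrC addrA subrK.
have dn n : N (d n) <= kappa ^+ n * N (d 0).
  elim: n => [|n IH]; first by rewrite expr0 mul1r.
  rewrite dK exprS -mulrA; apply: le_trans (hK _) _; exact: ler_wpM2l.
(* The geometric sum of the increments, with the denominator [1 - kappa] cleared. *)
have un n k : (1 - kappa) * N (u (n + k)%N - u n) <= (kappa ^+ n - kappa ^+ (n + k)) * N (d 0).
  elim: k => [|k IH]; first by rewrite addn0 !subrr (hnorm0 hV) mul0r mulr0.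
  rewrite addnS -[u _.+1](subrK (u (n + k)%N)) -addrA.
  have := hnormD hV (d (n + k)%N) (u (n + k)%N - u n); have := dn (n + k)%N.
  move: IH; rewrite exprS /d; move: (kappa ^+ (n + k)) (N _) (N _) (N _) (N _) => p A B C D.
  have : 0 < 1 - kappa by rewrite subr_gt0.
  nra.
have [l ul] : exists l, hconverges ip u l.
  case: hV => _ _ _ _; apply; apply: (hcauchy_le hV) => eps eps0.
  have [n0 hn0] : exists n0, forall n, (n0 <= n)%N -> kappa ^+ n * N (d 0) < (1 - kappa) * eps.
    have kk : `|kappa| < 1 by rewrite ger0_norm.
    have D1 : 0 < N (d 0) + 1 by rewrite ltr_wpDl ?hnorm_ge0.
    have del : 0 < (1 - kappa) * eps / (N (d 0) + 1).
      by rewrite divr_gt0// mulr_gt0// subr_gt0.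
    have /cvgr0Pnorm_lt/(_ _ del)[n0 _ hn0] := cvg_expr kk.
    exists n0 => n /hn0 /=; rewrite ger0_norm ?exprn_ge0// ltr_pdivlMr//.
    by apply: le_lt_trans; rewrite ler_wpM2l ?exprn_ge0// lerDl.
  exists n0 => m n n0m mn.
  have k1' : 0 < 1 - kappa by rewrite subr_gt0.
  rewrite -(ltr_pM2l k1'); apply: le_lt_trans (hn0 m n0m).
  have := un m (n - m)%N; rewrite subnKC// => /le_trans; apply.
  by rewrite ler_wpM2r ?hnorm_ge0// lerBlDr lerDl exprn_ge0.
exists l; apply/eqP; rewrite -subr_eq0; apply/eqP/(hnorm_eq0 hV).
apply/eqP; rewrite eq_le hnorm_ge0 andbT.
(* The residual splits as [S (l - u n)], at most [M eps], plus [S (u n) - y], which is [- d n / rho]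
   and so at most [2 eps / rho]. *)
have K0 : 0 <= M + 2 / rho by rewrite addr_ge0 ?divr_ge0 ?ltW.
apply: (ler_eps_mul K0) => eps eps0; rewrite add0r.
have [n hn] := ul eps eps0.
have -> : S l - y = S (l - u n) + (S (u n) - y) by rewrite (linear_opB _ _ bS.1) addrA subrK.
apply: le_trans (hnormD hV _ _) _; rewrite mulrDr lerD//.
  apply: le_trans (hM _) _; rewrite mulrC ler_wpM2r ?(ltW Mp)//.
  by rewrite (hnormBC hV) ltW// hn.
have : rho * N (S (u n) - y) = N (d n).
  by rewrite dE (hnormN hV) (hnormZ hV) normc_real gtr0_norm.
rewrite mulrA ler_pdivlMr// mulrC => ->.
rewrite /d -[u n.+1](subrK l) -addrA; apply: le_trans (hnormD hV _ _) _.
by rewrite mulr2n mulrDr mulr1 lerD// 1?(hnormBC hV l) ltW// hn.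
Qed.

(** Coercivity and Cauchy-Schwarz give [c |x| <= |S x|]. This makes [S] injective and bounds its
    inverse by [1 / c]. *)
Lemma coercive_inverse S (c : R) : is_bounded_op ip S -> 0 < c ->
  (forall x, c * N x ^+ 2 <= complex.Re (ip (S x) x)) ->
  exists G, is_bounded_op ip G /\ forall x, G (S x) = x.
Proof.
move=> bS c0 cS; have /choice[G SG] := coercive_surjective bS c0 cS.
have lower x : c * N x <= N (S x).
  have [->|x0] := eqVneq (N x) 0; first by rewrite mulr0 hnorm_ge0.
  have xp : 0 < N x by rewrite lt_neqAle eq_sym x0 hnorm_ge0.
  rewrite -(ler_pM2r xp) -mulrA -expr2; apply: le_trans (cS x) _.
  exact: le_trans (Re_le_normc _) (cauchy_schwarz hV _ _).
have inj x y : S x = S y -> x = y.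
  move=> xy; apply/eqP; rewrite -subr_eq0; apply/eqP/(hnorm_eq0 hV)/eqP.
  rewrite eq_le hnorm_ge0 andbT -(ler_pM2l c0) mulr0.
  by apply: le_trans (lower _) _; rewrite (linear_opB _ _ bS.1) xy subrr (hnorm0 hV).
exists G; split=> [|x]; last by apply: inj; rewrite SG.
split=> [a x y|]; first by apply: inj; rewrite bS.1 !SG.
by exists c^-1 => x; rewrite ler_pdivlMl// -{2}(SG x).
Qed.

(* [L k = (sum_j T_j^* T_j)^-1 T_k^*] *)
Lemma left_inverse_family (e : nat -> V) (r : nat) (T : 'I_r -> V -> V) (c : R) :
  is_onb ip e -> (forall k, is_bounded_op ip (T k)) -> 0 < c ->
  (forall x, c * N x ^+ 2 <= \sum_(k < r) N (T k x) ^+ 2) ->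
  exists L : 'I_r -> V -> V, (forall k, is_bounded_op ip (L k)) /\
    forall x, \sum_(k < r) L k (T k x) = x.
Proof.
move=> he bT c0 cT.
have /choice[A hA] := fun k => adjoint_exists he (bT k).
pose S x := \sum_(k < r) A k (T k x).
have bS : is_bounded_op ip S.
  by apply: bounded_op_sum => k; apply: (bounded_op_comp (hA k).1 (bT k)).
have cS x : c * N x ^+ 2 <= complex.Re (ip (S x) x).
  apply: le_trans (cT x) _; rewrite (ip_conj hV) Re_conj (ip_sumr hV) Re_sum.
  by apply: ler_sum => k _; rewrite -(hA k).2 (hnorm_sqr hV).
have [G [bG GS]] := coercive_inverse bS c0 cS.
exists (fun k => G \o A k); split=> [k|x].
  exact: bounded_op_comp bG (hA k).1.
by rewrite -[RHS]GS (linear_op_sum _ _ _ bG.1).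
Qed.

End BoundedOperators.

(** * Bessel sequences and frames *)

Section SquareSums.
Context {R : realType} {V : lmodType R[i]} {ip : V -> V -> R[i]}.
Hypothesis hV : is_hilbert ip.
Local Notation N := (hnorm ip).
Implicit Types (x y z : V).

Lemma esumZ_le (I : choiceType) (c : R) (a : I -> \bar R) :
  0 <= c -> (forall i, 0 <= a i)%E ->
  (\esum_(i in [set: I]) (c%:E * a i) <= c%:E * \esum_(i in [set: I]) a i)%E.
Proof.
move=> c0 a0; apply: ub_ereal_sup => _ [A hA <-].
rewrite -ge0_mule_fsumr//; apply: lee_wpmul2l; first by rewrite lee_fin.
by apply: esum_ge; exists A.
Qed.

Lemma coef_sqsum_ge0 (I : choiceType) (g : I -> V) x : (0 <= coef_sqsum ip g x)%E.
Proof. by apply: esum_ge0 => i _; rewrite lee_fin sqr_ge0. Qed.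

Lemma coef_sqsum_ge_term (I : choiceType) (g : I -> V) x i :
  ((normc (ip x (g i)) ^+ 2)%:E <= coef_sqsum ip g x)%E.
Proof.
apply: esum_ge; exists [set i]%classic; first by split=> //; exact: finite_set1.
by rewrite fsbig_set1.
Qed.

Lemma coef_sqsum_pair (I J : choiceType) (g : I * J -> V) x :
  coef_sqsum ip g x =
  (\esum_(i in [set: I]) coef_sqsum ip (fun j => g (i, j)) x)%E.
Proof.
rewrite /coef_sqsum (esum_esum (J := fun=> setT) (a := fun i j => ((normc (ip x (g (i, j)))) ^+ 2)%:E)).
  rewrite (_ : [set: I] `*`` (fun=> [set: J]) = setT)%classic; last by apply/seteqP; split.
  by apply: eq_esum => -[].
by move=> i j _ _; rewrite lee_fin sqr_ge0.
Qed.

Lemma coef_sqsum_swap (I J : choiceType) (g : I * J -> V) x :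
  coef_sqsum ip (fun p => g (p.2, p.1)) x = coef_sqsum ip g x.
Proof.
rewrite /coef_sqsum [RHS](reindex_esum [set: J * I]%classic setT (fun p => (p.2, p.1)))//.
split=> //.
- by move=> [a b] [c d] _ _ [-> ->].
- by move=> [a b] _; exists (b, a).
Qed.

Lemma coef_sqsum_fin (r : nat) (J : choiceType) (g : 'I_r -> J -> V) x :
  coef_sqsum ip (fun p : 'I_r * J => g p.1 p.2) x =
  (\sum_(k < r) coef_sqsum ip (g k) x)%E.
Proof.
rewrite coef_sqsum_pair/= esum_fset//= => [|i _]; last exact: coef_sqsum_ge0.
rewrite [RHS]fsbig_seq ?index_enum_uniq//.
rewrite (_ : [set` _] = setT)%classic//.
by apply/seteqP; split=> k //= _; exact: mem_index_enum.
Qed.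

Lemma bessel_gt0 (I : choiceType) (g : I -> V) : is_bessel ip g ->
  exists2 B : R, 0 < B & forall x, (coef_sqsum ip g x <= (B * N x ^+ 2)%:E)%E.
Proof.
move=> [B hB]; exists (`|B| + 1) => [|x]; first by rewrite ltr_wpDl.
apply: le_trans (hB x) _; rewrite lee_fin; apply: ler_wpM2r; first exact: sqr_ge0.
by apply: le_trans (ler_norm B) _; rewrite lerDl.
Qed.

Lemma frame_bessel (I : choiceType) (g : I -> V) : is_frame ip g -> is_bessel ip g.
Proof. by move=> [A [B [_ h]]]; exists B => x; case: (h x). Qed.

(** Termwise, the squared modulus of a sum of [r] numbers is at most [r] times the sum of their
    squared moduli. *)
Lemma bessel_sum (I : choiceType) (r : nat) (g : 'I_r -> I -> V) :
  (forall k, is_bessel ip (g k)) -> is_bessel ip (fun i => \sum_(k < r) g k i).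
Proof.
move=> /(_ _)/bessel_gt0/cid2-/all_sig2[B B0 hB].
exists (r%:R * \sum_(k < r) B k) => x.
have sq (i : I) : ((normc (ip x (\sum_(k < r) g k i)) ^+ 2)%:E <=
    r%:R%:E * \sum_(k < r) (normc (ip x (g k i)) ^+ 2)%:E)%E.
  by rewrite sumEFin -EFinM lee_fin (ip_sumr hV) sqr_normc_sum_le.
apply: le_trans (le_esum (fun i _ => sq i)) _.
apply: le_trans (esumZ_le (ler0n _ _) _) _.
  by move=> i; apply: sume_ge0 => k _; rewrite lee_fin sqr_ge0.
rewrite -mulrA EFinM; apply: lee_wpmul2l; first by rewrite lee_fin.
rewrite esum_sum => [|*]; last by rewrite lee_fin sqr_ge0.
by rewrite mulr_suml -sumEFin; apply: lee_sum => k _; exact: hB.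
Qed.

End SquareSums.

(** * Associated operators and their one-sided inverses in a single factor *)

Section OneFactor.
Context {R : realType} {V : lmodType R[i]} {ip : V -> V -> R[i]}.
Hypothesis hV : is_hilbert ip.
Local Notation N := (hnorm ip).
Context {e : nat -> V}.
Hypothesis he : is_onb ip e.
Implicit Types (x y z : V).

(** The Bessel bound is exactly what Riesz-Fischer asks of the coefficients [ip x (g n)]. Linearity
    is read off the coordinates, and Parseval turns the square sum into [|T x|^2], so [sqrt B]
    bounds [T]. *)
Lemma assoc_op_exists (g : nat -> V) : is_bessel ip g ->
  exists T, [/\ is_bounded_op ip T, is_assoc_op ip e g T,
    forall x n, ip (T x) (e n) = ip x (g n) &
    forall x, coef_sqsum ip g x = ((N (T x) ^+ 2)%:E)%E].
Proof.
move=> /bessel_gt0[B B0 hB].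
have bnd x n : \sum_(i < n) normc (ip x (g i)) ^+ 2 <= B * N x ^+ 2.
  by rewrite -lee_fin; apply: le_trans (coef_sqsum_ge_partial _ _ _) (hB x).
have /choice[T hT] : forall x, exists l,
    hconverges ip (fun n => \sum_(i < n) ip x (g i) *: e i) l /\
    forall n, ip l (e n) = ip x (g n).
  by move=> x; exact: (riesz_fischer hV he (c := fun i => ip x (g i)) (bnd x)).
have sqsumT x : coef_sqsum ip g x = ((N (T x) ^+ 2)%:E)%E.
  by rewrite -(parseval hV he); apply: eq_esum => i _; rewrite (hT x).2.
exists T; split=> [|x|x n|//]; [|exact: (hT x).1|exact: (hT x).2].
split=> [a x y|].
  by apply: (onb_ext hV he) => n; rewrite (ipDl hV) (ipZl hV) !(hT _).2 (ipDl hV) (ipZl hV).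
exists (Num.sqrt B) => x.
rewrite -(ler_pXn2r (n:=2))// ?nnegrE ?mulr_ge0 ?sqrtr_ge0 ?hnorm_ge0//.
by rewrite exprMn (sqr_sqrtr (ltW B0)) -lee_fin -sqsumT.
Qed.

Context {r : nat} {g : 'I_r -> nat -> V}.
Hypothesis hg : forall k, is_bessel ip (g k).

Lemma concatenation_frame (c : R) : 0 < c ->
  (forall x, ((c * N x ^+ 2)%:E <= \sum_(k < r) coef_sqsum ip (g k) x)%E) ->
  is_frame ip (fun p : 'I_r * nat => g p.1 p.2).
Proof.
move=> c0 low; have := hg; move=> /(_ _)/bessel_gt0/cid2-/all_sig2[B B0 hB].
exists c, (\sum_(k < r) B k); split=> // x; rewrite coef_sqsum_fin; split=> //.
by rewrite mulr_suml -sumEFin; apply: lee_sum => k _; exact: hB.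
Qed.

Lemma left_inverse_of_frame (c : R) (F : 'I_r -> V -> V) : 0 < c ->
  (forall x, ((c * N x ^+ 2)%:E <= \sum_(k < r) coef_sqsum ip (g k) x)%E) ->
  (forall k, is_bounded_op ip (F k)) ->
  (forall k x, coef_sqsum ip (g k) x = ((N (F k x) ^+ 2)%:E)%E) ->
  exists L : 'I_r -> V -> V, (forall k, is_bounded_op ip (L k)) /\
    forall x, \sum_(k < r) L k (F k x) = x.
Proof.
move=> c0 low bF hF; apply: (left_inverse_family hV he bF c0) => x.
by have := low x; under eq_bigr do rewrite hF; rewrite sumEFin lee_fin.
Qed.

(* The synthesis operator of [g k] is the adjoint of [F k]; a joint lower bound
   on the synthesis operators gives them a left inverse family, whose adjoints
   are the right inverse family. *)
Lemma right_inverse_of_synthesis_bound (c : R) (F : 'I_r -> V -> V) : 0 < c ->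
  (forall (a : nat -> R[i]) n, c * N (\sum_(m < n) a m *: e m) <=
     \sum_(k < r) N (\sum_(m < n) a m *: g k m)) ->
  (forall k, is_bounded_op ip (F k)) ->
  (forall k x n, ip (F k x) (e n) = ip x (g k n)) ->
  exists S : 'I_r -> V -> V, (forall k, is_bounded_op ip (S k)) /\
    forall x, \sum_(k < r) F k (S k x) = x.
Proof.
move=> c0 low bF hF.
have /choice[A hA] := fun k => adjoint_exists hV he (bF k).
have bA k := (hA k).1.
have Ae k n : A k (e n) = g k n.
  apply: (ip_ext hV) => z.
  by rewrite (ip_conj hV) -(hA k).2 hF -(ip_conj hV).
(* The hypothesis concerns finite combinations of the [e m]; density of partial sums and boundedness
   of the adjoints [A k] extend it to every [x]. *)
have lowA x : c * N x <= \sum_(k < r) N (A k x).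
  have [M hM] := choice (fun k => (bA k).2).
  have K0 : 0 <= c + \sum_(k < r) `|M k| by rewrite addr_ge0 ?sumr_ge0// ltW.
  apply: (ler_eps_mul K0) => eps eps0.
  have [n /(_ n (leqnn _)) hn] := onb_expansion hV he x eps0.
  set u := \sum_(i < n) _ in hn.
  have hu : c * N u <= \sum_(k < r) N (A k u).
    apply: le_trans (low (fun m => ip x (e m)) n) _; apply: ler_sum => k _.
    rewrite /u (linear_op_sum _ _ _ (bA k).1).
    by under [in leRHS]eq_bigr do rewrite (linear_opZ _ _ (bA k).1) Ae.
  have h1 : N x <= N u + eps.
    rewrite -[x](subrK u) addrC; apply: le_trans (hnormD hV _ _) _.
    by rewrite lerD2l (hnormBC hV) ltW.
  have h2 k : N (A k u) <= N (A k x) + eps * `|M k|.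
    rewrite -[u](subrK x) addrC (linear_opD _ _ (bA k).1).
    apply: le_trans (hnormD hV _ _) _; rewrite lerD2l.
    apply: le_trans (hM k _) _; apply: le_trans (ler_wpM2r (hnorm_ge0 _ _) (ler_norm _)) _.
    by rewrite mulrC ler_wpM2r// ltW.
  have h3 : \sum_(k < r) N (A k u) <= \sum_(k < r) N (A k x) + eps * \sum_(k < r) `|M k|.
    by rewrite mulr_sumr -big_split/=; apply: ler_sum.
  have h4 : c * N x <= c * (N u + eps) by rewrite ler_wpM2l// ltW.
  move: h4 hu h3; rewrite !mulrDr [eps * c]mulrC; lra.
(* Passing from a sum of norms to a sum of squares costs a factor [r]; [r.+1] keeps the denominator
   nonzero when [r = 0]. *)
have cc : 0 < c ^+ 2 / r.+1%:R by rewrite divr_gt0 ?exprn_gt0 ?ltr0n.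
have [|L [bL LA]] := left_inverse_family hV he bA cc.
  move=> x; rewrite mulrAC ler_pdivrMr ?ltr0n// -exprMn.
  apply: le_trans (_ : (\sum_(k < r) N (A k x)) ^+ 2 <= _).
    rewrite ler_pXn2r ?nnegrE ?mulr_ge0 ?hnorm_ge0 ?(ltW c0) ?sumr_ge0// => k _.
    exact: hnorm_ge0.
  apply: le_trans (sqr_sum_le _ _) _.
  rewrite /index_enum -enumT size_enum_ord mulrC ler_wpM2l ?ler_nat//.
  by apply: sumr_ge0 => k _; exact: sqr_ge0.
(* Taking adjoints in [sum_k L_k A_k = I], where [A k] is the adjoint of [F k], gives
   [sum_k F_k S_k = I] with [S k] the adjoint of [L k]. *)
have /choice[S hS] := fun k => adjoint_exists hV he (bL k).
exists S; split=> [k|x]; first exact: (hS k).1.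
apply: (ip_ext hV) => z; rewrite -[z in RHS]LA (ip_suml hV) (ip_sumr hV).
apply: eq_bigr => k _.
by rewrite (hA k).2 (ip_conj hV) -(hS k).2 -(ip_conj hV).
Qed.

End OneFactor.

(** * Families in a tensor product *)

(** Rows are added one at a time, each raising the rank. If every row in [P] lay in the row space of
    [A], the columns of the cokernel of [A] would be annihilated by all of [P] and so vanish,
    forcing rank [r]. *)
Lemma row_full_of_separating {K : fieldType} (r : nat) (P : 'rV[K]_r -> Prop) :
  (forall c : 'cV[K]_r, (forall a, P a -> a *m c = 0) -> c = 0) ->
  exists m (A : 'M[K]_(m, r)), (forall i, P (row i A)) /\ row_full A.
Proof.
move=> sep.
suff : forall d, (d <= r)%N ->
    exists m (A : 'M[K]_(m, r)), (forall i, P (row i A)) /\ (d <= \rank A)%N.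
  move=> /(_ r (leqnn r))[m [A [PA rA]]]; exists m, A; split=> //.
  by rewrite /row_full eqn_leq rank_leq_col.
elim=> [_|d IH dr]; first by exists 0%N, 0; split=> // -[].
have [m [A [PA rA]]] := IH (ltnW dr).
have [rA'|rA'] := ltnP d (\rank A); first by exists m, A.
have rAd : \rank A = d by apply/eqP; rewrite eqn_leq rA rA'.
have [a [Pa aA]] : exists a, P a /\ ~~ (a <= A)%MS.
  apply: contrapT => nex.
  have : cokermx A = 0.
    apply/matrixP => i j; rewrite mxE.
    have /matrixP/(_ i 0) : col j (cokermx A) = 0; last by rewrite !mxE.
    apply: sep => a Pa; rewrite colE mulmxA.
    have /submxP[D ->] : (a <= A)%MS by apply: contrapT => /negP h; apply: nex; exists a.
    by rewrite -[D *m A *m _]mulmxA mulmx_coker mulmx0 mul0mx.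
  by move/eqP; rewrite -mxrank_eq0 mxrank_coker rAd subn_eq0 leqNgt dr.
exists (1 + m)%N, (col_mx a A); split=> [i|].
  case: (split_ordP i) => k ->; last by rewrite rowKd.
  by rewrite rowKu (ord1 k) (_ : row 0 a = a)//; apply/rowP => j; rewrite mxE.
rewrite -addsmxE ltnNge -rAd; apply: contra aA => h.
have aAA : (a + A <= A)%MS by rewrite -(geq_leqif (mxrank_leqif_sup (addsmxSr a A))).
exact: submx_trans (addsmxSl a A) aAA.
Qed.

Section TensorProduct.
Context {R : realType}.
Context {H1 : lmodType R[i]} {ip1 : H1 -> H1 -> R[i]}.
Context {H2 : lmodType R[i]} {ip2 : H2 -> H2 -> R[i]}.
Context {H : lmodType R[i]} {ip : H -> H -> R[i]}.
Context {t : H1 -> H2 -> H}.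

(** Symmetry that lets results about the first factor be applied to the second. *)
Lemma tensor_product_swap : is_tensor_product ip1 ip2 ip t ->
  is_tensor_product ip2 ip1 ip (fun y x => t x y).
Proof.
move=> [tl tr tip dense]; split=> [a x x' y|a x y y'|x y x' y'|z eps eps0].
- exact: tr.
- exact: tl.
- by rewrite tip mulrC.
have [s hs] := dense z eps eps0.
by exists [seq (p.2, p.1) | p <- s]; rewrite big_map.
Qed.

Hypotheses (hH1 : is_hilbert ip1) (hH2 : is_hilbert ip2) (hH : is_hilbert ip).
Hypothesis ht : is_tensor_product ip1 ip2 ip t.

Lemma tensor0l y : t 0 y = 0.
Proof.
case: ht => h _ _ _; have := h 1 0 0 y; rewrite !scale1r addr0 => /eqP.
by rewrite -subr_eq0 opprD addNKr oppr_eq0 => /eqP.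
Qed.

Lemma tensorDl x x' y : t (x + x') y = t x y + t x' y.
Proof. by case: ht => h _ _ _; rewrite -[x in LHS]scale1r h scale1r. Qed.

Lemma tensorZl a x y : t (a *: x) y = a *: t x y.
Proof. by case: ht => h _ _ _; rewrite -[a *: x]addr0 h tensor0l addr0. Qed.

Lemma tensor_suml (I : Type) (s : seq I) (P : pred I) (F : I -> H1) y :
  t (\sum_(i <- s | P i) F i) y = \sum_(i <- s | P i) t (F i) y.
Proof. by apply: (big_morph (t^~ y) (fun x x' => tensorDl x x' y)); exact: tensor0l. Qed.

Lemma ip_tensor x y x' y' : ip (t x y) (t x' y') = ip1 x x' * ip2 y y'.
Proof. by case: ht. Qed.

Lemma hnorm_tensor x y : hnorm ip (t x y) = hnorm ip1 x * hnorm ip2 y.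
Proof.
apply/eqP; rewrite -(eqrXn2 (n:=2))// ?mulr_ge0 ?hnorm_ge0//.
rewrite (hnorm_sqr hH) ip_tensor (ip_self hH1) (ip_self hH2) exprMn.
by rewrite -complex_of_realM.
Qed.

(* The slice of [z] along [y] is the Riesz representative of
   [x |-> ip (t x y) z]; Parseval for it compares [f] with an orthonormal
   basis. *)
Lemma slice_bessel (e1 : nat -> H1) (f : nat -> H1) (B : R) : is_onb ip1 e1 ->
  (forall x, (coef_sqsum ip1 f x <= (B * hnorm ip1 x ^+ 2)%:E)%E) ->
  forall y z, (coef_sqsum ip (fun m => t (f m) y) z <=
               B%:E * coef_sqsum ip (fun m => t (e1 m) y) z)%E.
Proof.
move=> he1 hB y z.
have [v hv] : exists v, forall x, ip (t x y) z = ip1 x v.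
  apply: (riesz_representation hH1 he1 (M := hnorm ip2 y * hnorm ip z)) => [a x x'|x].
    by rewrite tensorDl tensorZl (ipDl hH) (ipZl hH).
  apply: le_trans (cauchy_schwarz hH _ _) _.
  by rewrite hnorm_tensor -mulrA mulrC -mulrA.
have slice g : coef_sqsum ip (fun m => t (g m) y) z = coef_sqsum ip1 g v.
  by apply: eq_esum => m _; rewrite (ip_conj hH) hv -(ip_conj hH1).
by rewrite !slice (parseval hH1 he1) -EFinM.
Qed.

Lemma coef_sqsum_le_single (F : nat * nat -> H) z n :
  (coef_sqsum ip (fun m => F (m, n)) z <= coef_sqsum ip F z)%E.
Proof.
rewrite coef_sqsum_pair; apply: le_esum => m _.
exact: (coef_sqsum_ge_term (fun j => F (m, j)) z n).
Qed.

Context {r : nat} {f1 : 'I_r -> nat -> H1} {f2 : 'I_r -> nat -> H2}.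
Let F := fun mn : nat * nat => \sum_(k < r) t (f1 k mn.1) (f2 k mn.2).

Lemma ip_tensor_family x y m n :
  ip (t x y) (F (m, n)) = \sum_(k < r) ip1 x (f1 k m) * ip2 y (f2 k n).
Proof. by rewrite /F (ip_sumr hH); apply: eq_bigr => k _; rewrite ip_tensor. Qed.

(* Independence of [f2] makes finitely many rows [(ip2 y (f2 k n))_k] span
   [C^r], so [ip1 x (f1 l m)] is a fixed finite combination of the numbers
   [ip (t x y) (F (m, n))]. *)
Lemma factor_bessel : seq_lin_indep f2 -> is_bessel ip F ->
  forall l, is_bessel ip1 (f1 l).
Proof.
move=> indep /bessel_gt0[B B0 hB] l.
pose P (a : 'rV[R[i]]_r) := exists y n, a = \row_k ip2 y (f2 k n).
have [|p [A [PA fullA]]] := @row_full_of_separating _ r P.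
  (* A column [c] killed by all rows gives [u = sum_k (c k)^* f2 k n]. The row with [y = u] yields
     [<u,u> = 0], so the conjugates of [c] form a linear relation among the sequences [f2 k]. *)
  move=> c hc; apply/colP => k; rewrite [RHS]mxE; apply: (inv_inj conjCK).
  rewrite conjC0; move: k; apply: (indep (fun k => (c k 0)^*)) => n.
  set u := \sum_(k < r) _; have uu : ip2 u u = 0.
    have := hc _ (ex_intro _ u (ex_intro _ n erefl)).
    move=> /matrixP/(_ 0 0); rewrite !mxE => h; rewrite {2}/u (ip_sumr hH2) -[RHS]h.
    by apply: eq_bigr => k _; rewrite (ipZr hH2) conjCK mxE mulrC.
  by case: hH2 => _ _ _ h _; exact: h.
have /choice[y /choice[n yn]] := PA.
have Ayn i k : A i k = ip2 (y i) (f2 k (n i)).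
  by have /rowP/(_ k) := yn i; rewrite !mxE.
(* [D] is a left inverse of [A], so its row [l] isolates the term [k = l] in the coefficients of the
   family. *)
have [D DA] := row_fullP fullA.
have rec x m : ip1 x (f1 l m) = \sum_(i < p) D l i * ip (t x (y i)) (F (m, n i)).
  under eq_bigr do rewrite ip_tensor_family mulr_sumr.
  rewrite exchange_big/= (bigD1 l)//= [X in _ + X]big1 ?addr0 => [|k kl].
    have /matrixP/(_ l l) := DA; rewrite !mxE eqxx => D1.
    rewrite -[LHS]mul1r -[1]D1 mulr_suml; apply: eq_bigr => i _.
    by rewrite Ayn -mulrA [ip2 _ _ * _]mulrC.
  have /matrixP/(_ l k) := DA; rewrite !mxE eq_sym (negbTE kl) => D0.
  transitivity ((\sum_(i < p) D l i * A i k) * ip1 x (f1 k m)); last by rewrite D0 mul0r.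
  by rewrite mulr_suml; apply: eq_bigr => i _; rewrite Ayn -mulrA [ip2 _ _ * _]mulrC.
(* The factor [p] comes from squaring a sum of [p] terms; [B |y i|^2 |x|^2] bounds the square sum of
   the whole family at [t x (y i)], hence that of its subfamily with second index [n i]. *)
exists (\sum_(i < p) p%:R * normc (D l i) ^+ 2 * (B * hnorm ip2 (y i) ^+ 2)) => x.
have sq m : ((normc (ip1 x (f1 l m)) ^+ 2)%:E <= \sum_(i < p)
    (p%:R * normc (D l i) ^+ 2)%:E * (normc (ip (t x (y i)) (F (m, n i))) ^+ 2)%:E)%E.
  rewrite rec; under [leRHS]eq_bigr do rewrite -EFinM.
  rewrite sumEFin lee_fin.
  apply: le_trans (sqr_normc_sum_le _) _; rewrite mulr_sumr; apply: ler_sum => i _.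
  by rewrite ComplexField.Normc.normcM exprMn mulrA.
apply: le_trans (le_esum (fun m _ => sq m)) _.
have c0 i : 0 <= p%:R * normc (D l i) ^+ 2 by rewrite mulr_ge0 ?sqr_ge0.
rewrite esum_sum => [|*]; last by rewrite mule_ge0 ?lee_fin ?sqr_ge0.
rewrite mulr_suml -sumEFin; apply: lee_sum => i _.
apply: le_trans (esumZ_le (c0 i) _) _; first by move=> m; rewrite lee_fin sqr_ge0.
rewrite -(mulrA (p%:R * _)) [leRHS]EFinM; apply: lee_wpmul2l; first by rewrite lee_fin.
apply: le_trans (coef_sqsum_le_single F (t x (y i)) (n i)) _.
apply: le_trans (hB _) _; rewrite hnorm_tensor lee_fin le_eqVlt.
by apply/orP; left; apply/eqP; ring.
Qed.

(** The frame bound is tested on [t x (e2 0)], where [e2 0] is a unit vector. Summing over [n]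
    first, the Bessel bounds of the [f2 k] at [e2 0] leave only the square sums of the [f1 k] at
    [x]. *)
Lemma frame_lower_factor (e2 : nat -> H2) : is_onb ip2 e2 ->
  (forall k, is_bessel ip2 (f2 k)) -> is_frame ip F ->
  exists2 c : R, 0 < c &
    forall x, ((c * hnorm ip1 x ^+ 2)%:E <= \sum_(k < r) coef_sqsum ip1 (f1 k) x)%E.
Proof.
move=> he2 /(_ _)/bessel_gt0/cid2-/all_sig2[B B0 hB] [A [B' [A0 hA]]].
(* [K] dominates each [r B_k]; the summand 1 keeps it positive when [r = 0]. *)
pose K := 1 + r%:R * \sum_(k < r) B k.
have sB0 : 0 <= \sum_(k < r) B k by apply: sumr_ge0 => k _; exact: ltW.
have K0 : 0 < K by rewrite ltr_pwDl// mulr_ge0.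
exists (A / K) => [|x]; first by rewrite divr_gt0.
have BK k : r%:R * B k <= K.
  apply: le_trans (_ : r%:R * \sum_(j < r) B j <= _); last by rewrite lerDr.
  rewrite ler_wpM2l// (bigD1 k)//= lerDl; apply: sumr_ge0 => j _; exact: ltW.
have e20 : hnorm ip2 (e2 0%N) = 1.
  by rewrite /hnorm he2.1 eqxx sqrtr1.
suff low : (coef_sqsum ip F (t x (e2 0%N)) <=
    K%:E * \sum_(k < r) coef_sqsum ip1 (f1 k) x)%E.
  have [+ _] := hA (t x (e2 0%N)); rewrite hnorm_tensor e20 mulr1.
  move=> /le_trans/(_ low); rewrite mulrAC -lee_pdivrMl//.
  by rewrite -EFinM mulrC.
rewrite coef_sqsum_pair.
have row m : (coef_sqsum ip (fun n => F (m, n)) (t x (e2 0%N)) <=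
    K%:E * \sum_(k < r) (normc (ip1 x (f1 k m)) ^+ 2)%:E)%E.
  have sq n : ((normc (ip (t x (e2 0%N)) (F (m, n))) ^+ 2)%:E <= \sum_(k < r)
      (r%:R * normc (ip1 x (f1 k m)) ^+ 2)%:E * (normc (ip2 (e2 0%N) (f2 k n)) ^+ 2)%:E)%E.
    rewrite ip_tensor_family; under [leRHS]eq_bigr do rewrite -EFinM.
    rewrite sumEFin lee_fin.
    apply: le_trans (sqr_normc_sum_le _) _; rewrite mulr_sumr; apply: ler_sum => i _.
    by rewrite ComplexField.Normc.normcM exprMn mulrA.
  apply: le_trans (le_esum (fun n _ => sq n)) _.
  have c0 k : 0 <= r%:R * normc (ip1 x (f1 k m)) ^+ 2 by rewrite mulr_ge0 ?sqr_ge0.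
  rewrite esum_sum => [|*]; last by rewrite mule_ge0 ?lee_fin ?sqr_ge0.
  rewrite ge0_sume_distrr => [|k _]; last by rewrite lee_fin sqr_ge0.
  apply: lee_sum => k _.
  apply: le_trans (esumZ_le (c0 k) _) _; first by move=> n; rewrite lee_fin sqr_ge0.
  apply: le_trans (lee_wpmul2l _ (hB k (e2 0%N))) _; first by rewrite lee_fin.
  rewrite e20 expr1n mulr1 -!EFinM lee_fin mulrAC.
  by rewrite ler_wpM2r ?sqr_ge0.
apply: le_trans (le_esum (fun m _ => row m)) _.
apply: le_trans (esumZ_le (ltW K0) _) _.
  by move=> m; apply: sume_ge0 => k _; rewrite lee_fin sqr_ge0.
by rewrite esum_sum// => *; rewrite lee_fin sqr_ge0.
Qed.

(** The vectors [F (m, 0)] are images under [U] of an orthonormal system, so [W], the inverse of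
    [U], bounds the norm of a coefficient vector by that of [sum_m a_m F (m, 0)]. Regrouped by [k],
    the latter is a sum of elementary tensors with second factors [f2 k 0]. *)
Lemma riesz_synthesis_factor (e1 : nat -> H1) : is_onb ip1 e1 -> is_riesz_basis ip F ->
  exists2 c : R, 0 < c & forall (a : nat -> R[i]) n,
    c * hnorm ip1 (\sum_(m < n) a m *: e1 m) <=
    \sum_(k < r) hnorm ip1 (\sum_(m < n) a m *: f1 k m).
Proof.
move=> he1 [_ [u [U [hu [bU [W [bW WU _]]] FU]]]].
have [M M0 hM] := bounded_op_gt0 bW.
pose K := 1 + \sum_(k < r) hnorm ip2 (f2 k 0%N).
have S0 : 0 <= \sum_(k < r) hnorm ip2 (f2 k 0%N).
  by apply: sumr_ge0 => k _; exact: hnorm_ge0.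
have K0 : 0 < K by rewrite ltr_pwDl.
exists (M * K)^-1 => [|a n]; first by rewrite invr_gt0 mulr_gt0.
rewrite ler_pdivrMl ?mulr_gt0//.
have u0 : forall m n, ip (u (m, 0%N)) (u (n, 0%N)) = (m == n)%:R.
  by move=> m n'; rewrite hu.1 xpair_eqE eqxx andbT.
have sum_nat (E : lmodType R[i]) (g : nat -> E) :
  \sum_(m < n) a m *: g m = \sum_(m <- index_iota 0 n) a m *: g m.
  by rewrite -(big_mkord xpredT (fun m => a m *: g m)).
(* Both norms are the l2 norm of [a], as both systems are orthonormal. *)
have -> : hnorm ip1 (\sum_(m < n) a m *: e1 m) =
          hnorm ip (\sum_(m < n) a m *: u (m : nat, 0%N)).
  apply/eqP; rewrite -(eqrXn2 (n:=2))// ?hnorm_ge0// !sum_nat.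
  rewrite (hnorm_orthonormal hH1 he1.1) ?iota_uniq//.
  by rewrite (sum_nat _ (fun m => u (m, 0%N))) (hnorm_orthonormal hH u0) ?iota_uniq.
rewrite -[X in hnorm ip X](WU) (linear_op_sum _ _ _ bU.1).
apply: le_trans (hM _) _; rewrite -mulrA ler_wpM2l ?(ltW M0)//.
have -> : \sum_(m < n) U (a m *: u (m : nat, 0%N)) =
    \sum_(k < r) t (\sum_(m < n) a m *: f1 k m) (f2 k 0%N).
  under eq_bigr do rewrite (linear_opZ _ _ bU.1) -FU scaler_sumr.
  rewrite exchange_big/=; apply: eq_bigr => k _; rewrite tensor_suml.
  by apply: eq_bigr => m _; rewrite tensorZl.
apply: le_trans (hnorm_sum hH _ _ _) _; rewrite mulr_sumr; apply: ler_sum => k _.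
rewrite hnorm_tensor mulrC ler_wpM2r ?hnorm_ge0//.
apply: le_trans (_ : \sum_(k < r) hnorm ip2 (f2 k 0%N) <= _); last by rewrite lerDr.
rewrite (bigD1 k)//= lerDl; apply: sumr_ge0 => j _; exact: hnorm_ge0.
Qed.

End TensorProduct.

(** * Exchanging the two indices of a family *)

Lemma bessel_swap {R : realType} (V : lmodType R[i]) (ip : V -> V -> R[i])
  (I J : choiceType) (g : I * J -> V) :
  is_bessel ip g -> is_bessel ip (fun p => g (p.2, p.1)).
Proof. by move=> [B hB]; exists B => x; rewrite coef_sqsum_swap. Qed.

Lemma frame_swap {R : realType} (V : lmodType R[i]) (ip : V -> V -> R[i])
  (I J : choiceType) (g : I * J -> V) :
  is_frame ip g -> is_frame ip (fun p => g (p.2, p.1)).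
Proof.
by move=> [A [B [A0 hAB]]]; exists A, B; split=> // x; rewrite coef_sqsum_swap.
Qed.

Lemma riesz_basis_swap {R : realType} (V : lmodType R[i]) (ip : V -> V -> R[i])
  (I J : choiceType) (g : I * J -> V) :
  is_riesz_basis ip g -> is_riesz_basis ip (fun p => g (p.2, p.1)).
Proof.
move=> [/frame_swap fg [u [U [[uu u0] bU gU]]]]; split=> //.
exists (fun p => u (p.2, p.1)), U; split=> [||p]; [|by []|exact: gU].
split=> [[a b] [c d]|x hx]; first by rewrite uu !xpair_eqE andbC.
by apply: u0 => -[a b]; exact: (hx (b, a)).
Qed.

(** * From factors to the tensor family and back *)

Section Factors.
Context {R : realType}.
Context {H1 : lmodType R[i]} {ip1 : H1 -> H1 -> R[i]}.
Context {H2 : lmodType R[i]} {ip2 : H2 -> H2 -> R[i]}.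
Context {H : lmodType R[i]} {ip : H -> H -> R[i]}.
Context {t : H1 -> H2 -> H}.
Hypotheses (hH1 : is_hilbert ip1) (hH2 : is_hilbert ip2) (hH : is_hilbert ip).
Hypothesis ht : is_tensor_product ip1 ip2 ip t.
Context {e1 : nat -> H1} {e2 : nat -> H2}.
Hypotheses (he1 : is_onb ip1 e1) (he2 : is_onb ip2 e2).

(** For each fixed [m] the sequence [g] is replaced by [e2] at cost [B2], then for each fixed [n]
    the sequence [f] by [e1] at cost [B1]. What remains is Bessel's inequality for an orthonormal
    family of tensors. *)
Lemma bessel_tensor (f : nat -> H1) (g : nat -> H2) :
  is_bessel ip1 f -> is_bessel ip2 g ->
  is_bessel ip (fun p : nat * nat => t (f p.1) (g p.2)).
Proof.
move=> /bessel_gt0[B1 B10 hB1] /bessel_gt0[B2 B20 hB2].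
exists (B2 * B1) => z.
have slice1 := slice_bessel hH1 hH2 hH ht he1 hB1.
have slice2 := slice_bessel hH2 hH1 hH (tensor_product_swap ht) he2 hB2.
have step2 : (coef_sqsum ip (fun p : nat * nat => t (f p.1) (g p.2)) z <=
    B2%:E * coef_sqsum ip (fun p : nat * nat => t (f p.1) (e2 p.2)) z)%E.
  rewrite !coef_sqsum_pair/=.
  apply: le_trans (le_esum (fun m _ => slice2 (f m) z)) _.
  by apply: esumZ_le (ltW B20) _ => m; exact: coef_sqsum_ge0.
have step1 : (coef_sqsum ip (fun p : nat * nat => t (f p.1) (e2 p.2)) z <=
    B1%:E * coef_sqsum ip (fun p : nat * nat => t (e1 p.2) (e2 p.1)) z)%E.
  (* The indices are swapped so that the sum over the first factor becomes the inner one. *)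
  rewrite -coef_sqsum_swap !coef_sqsum_pair/=.
  apply: le_trans (le_esum (fun n _ => slice1 (e2 n) z)) _.
  by apply: esumZ_le (ltW B10) _ => m; exact: coef_sqsum_ge0.
have ortho : forall p q : nat * nat,
    ip (t (e1 p.2) (e2 p.1)) (t (e1 q.2) (e2 q.1)) = (p == q)%:R.
  move=> [a b] [c d]; rewrite (ip_tensor ht) he1.1 he2.1 xpair_eqE -natrM.
  by rewrite mulnb andbC.
apply: (le_trans step2); rewrite -mulrA EFinM lee_wpmul2l ?lee_fin ?(ltW B20)//.
apply: (le_trans step1); rewrite EFinM lee_wpmul2l ?lee_fin ?(ltW B10)//.
exact: coef_sqsum_orthonormal.
Qed.

Context {r : nat} {f1 : 'I_r -> nat -> H1} {f2 : 'I_r -> nat -> H2}.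
Let F := fun mn : nat * nat => \sum_(k < r) t (f1 k mn.1) (f2 k mn.2).

Hypotheses (bf1 : forall k, is_bessel ip1 (f1 k))
  (bf2 : forall k, is_bessel ip2 (f2 k)).

Lemma frame_factor : is_frame ip F -> concl_ii ip1 e1 f1.
Proof.
move=> /(frame_lower_factor hH1 hH2 hH ht he2 bf2)[c c0 low].
have /choice[T hT] := fun k => assoc_op_exists hH1 he1 (bf1 k).
have bT k : is_bounded_op ip1 (T k) by case: (hT k).
split; last exact (concatenation_frame bf1 c0 low).
exists T; split=> [k|]; first by case: (hT k).
by apply: (left_inverse_of_frame hH1 he1 c0 low bT) => k; case: (hT k).
Qed.

(** The operators [T] are those obtained from the frame property, so that left and right inverses
    refer to the same family. *)
Lemma riesz_basis_factor : is_riesz_basis ip F -> concl_iii ip1 e1 f1.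
Proof.
move=> rF; have [c c0 low] := riesz_synthesis_factor hH1 hH2 hH ht he1 rF.
have [[T [hT [L hL]]] fr] := frame_factor rF.1.
split=> //; exists T; split=> //; split; first by exists L.
apply: (right_inverse_of_synthesis_bound hH1 he1 c0 low) => [k|k x n].
  exact: (hT k).1.
(* The coordinates of [T k x] are recovered from the convergent series: the coefficient at [e1 n] is
   constant from the partial sum of length [n.+1] on. *)
apply: (hconverges_ip hH1 (n0 := n.+1) ((hT k).2 x)) => N nN.
rewrite -(big_mkord xpredT (fun i => ip1 x (f1 k i) *: e1 i)).
by rewrite (orthonormal_ip hH1 he1.1) ?iota_uniq// mem_index_iota nN.
Qed.

End Factors.

Theorem theorem3p2 (R : realType)
  (H1 : lmodType R[i]) (ip1 : H1 -> H1 -> R[i]) (hH1 : is_hilbert ip1)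
  (H2 : lmodType R[i]) (ip2 : H2 -> H2 -> R[i]) (hH2 : is_hilbert ip2)
  (H : lmodType R[i]) (ip : H -> H -> R[i]) (hH : is_hilbert ip)
  (t : H1 -> H2 -> H) (ht : is_tensor_product ip1 ip2 ip t)
  (e1 : nat -> H1) (he1 : is_onb ip1 e1)
  (e2 : nat -> H2) (he2 : is_onb ip2 e2)
  (r : nat)
  (f1 : 'I_r -> nat -> H1) (hf1 : seq_lin_indep f1)
  (f2 : 'I_r -> nat -> H2) (hf2 : seq_lin_indep f2) :
  let F : nat * nat -> H :=
    fun mn => \sum_(k < r) t (f1 k mn.1) (f2 k mn.2) in
  [/\ (is_bessel ip F <->
         (forall k, is_bessel ip1 (f1 k)) /\ (forall k, is_bessel ip2 (f2 k))),
      (is_frame ip F -> concl_ii ip1 e1 f1 /\ concl_ii ip2 e2 f2) &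
      (is_riesz_basis ip F -> concl_iii ip1 e1 f1 /\ concl_iii ip2 e2 f2)].
Proof.
move=> F.
pose F' := fun mn : nat * nat => \sum_(k < r) t (f1 k mn.2) (f2 k mn.1).
have ht' := tensor_product_swap ht.
have bF1 : is_bessel ip F -> forall k, is_bessel ip1 (f1 k).
  exact: (factor_bessel hH1 hH2 hH ht hf2).
have bF2 : is_bessel ip F -> forall k, is_bessel ip2 (f2 k).
  by move=> /bessel_swap; exact: (factor_bessel hH2 hH1 hH ht' hf1).
have fF : is_frame ip F -> concl_ii ip1 e1 f1 /\ concl_ii ip2 e2 f2.
  move=> frF; have bF := frame_bessel frF; split.
    exact: (frame_factor hH1 hH2 hH ht he1 he2 (bF1 bF) (bF2 bF)).
  exact: (frame_factor hH2 hH1 hH ht' he2 he1 (bF2 bF) (bF1 bF) (frame_swap frF)).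
split=> [|//|rF].
  split=> [bF|[b1 b2]]; first by split; [exact: bF1|exact: bF2].
  (* The family is a sum of [r] families of elementary tensors, each of them Bessel. *)
  by apply: bessel_sum => // k; exact: (bessel_tensor hH1 hH2 hH ht he1 he2).
have bF := frame_bessel rF.1; split.
  exact: (riesz_basis_factor hH1 hH2 hH ht he1 he2 (bF1 bF) (bF2 bF)).
exact: (riesz_basis_factor hH2 hH1 hH ht' he2 he1 (bF2 bF) (bF1 bF) (riesz_basis_swap rF)).
Qed.
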